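(* Let $\varphi\colon\underline{A}[y_{C_2/C_2}]\to\underline{A}[x_{C_2/C_2}]$ and $\psi\colon\underline{A}[y_{C_2/C_2}]\to\underline{A}$ be maps which at level $C_2/e$ send $y$ to $x^2\in\mathbb{Z}[x]$ and to $-1\in\mathbb{Z}$, respectively, and let $$\underline{G}=\underline{A}[x_{C_2/C_2}]\,\Box_{\underline{A}[y_{C_2/C_2}]}\,\underline{A}$$ be the associated relative box product. There is no way to define a $C_2$-action on $\underline{G}$ which satisfies the conditions (1) the $C_2$-action is $\underline{A}$-linear and is trivial on $\underline{A}[y_{C_2/C_2}]$, (2) $\varphi$ is a morphism of Tambara functors that doubles the degree, (3) $\psi$ is a morphism of Tambara functors, such that $\underline{A}\cong\underline{G}^{C_2}$. In particular, inverting $2$ does not yield a $C_2$-Galois extension $\underline{A}[\tfrac12]\to\underline{G}[\tfrac12]$.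
   Context: All Tambara functors are $C_2$-Tambara functors; $C_2=\langle\tau\rangle$ is the group of order two. $\underline{A}$ is the Burnside Tambara functor: $\underline{A}(C_2/e)=\mathbb{Z}$ and $\underline{A}(C_2/C_2)=\mathbb{Z}[t]/(t^2-2t)$ with $t=[C_2/e]$, $\mathrm{res}(t)=2$, $\mathrm{tr}(1)=t$, $\mathrm{norm}(-1)=t-1$. $\underline{A}[x_{C_2/C_2}]$ is the free Tambara functor on one generator at level $C_2/C_2$. It has $\underline{A}[x_{C_2/C_2}](C_2/e)=\mathbb{Z}[x]$ with trivial Weyl action, and $\underline{A}[x_{C_2/C_2}](C_2/C_2)=\mathbb{Z}[t]/(t^2-2t)[x_*,n_*]/(tn_*-tx_*^2)$, where $x_*$ is the generator, $\mathrm{res}(x_* )=x$, $\mathrm{res}(n_* )=x^2$, $\mathrm{tr}(p(x))=t\,p(x_* )$ and $\mathrm{norm}(x)=n_*$. $\underline{A}[y_{C_2/C_2}]$ is another copy, with generator named $y$. Both levels are quotients of polynomial algebras and are graded with $|x|=|x_*|=1$, $|n_*|=2$, $|t|=0$. The $C_2$-action (distinct from the Weyl action) is by morphisms of Tambara functors. It is given on the pushout diagram defining $\underline{G}$ by a degree-preserving action on $\underline{A}[x_{C_2/C_2}]$ with $\tau(x)=-x$ at level $C_2/e$, together with the trivial actions on $\underline{A}[y_{C_2/C_2}]$ and $\underline{A}$, and it induces the action on $\underline{G}$. The fixed points $\underline{G}^{C_2}$ are formed levelwise. A monomorphism $\underline{R}\to\underline{T}$ of Tambara functors, with $C_2$ acting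 on $\underline{T}$ by $\underline{R}$-algebra maps of Tambara functors, is a $C_2$-Galois extension if it induces $\underline{R}\cong\underline{T}^{C_2}$ (levelwise fixed points) and if $\underline{T}\Box_{\underline{R}}\underline{T}\to\prod_{h\in C_2}\underline{T}$, with $h$-component $\mu\circ(\mathrm{id}\Box h)$, is an isomorphism, $\mu$ being the multiplication. The last assertion refers to the induced action after inverting $2$. *)

(* Defs.v *)
From HB Require Import structures.
From mathcomp Require Import all_boot all_order all_algebra.
From mathcomp Require Import generic_quotient ring_quotient boolp.
From mathcomp Require Import ring.

Set Implicit Arguments.
Unset Strict Implicit.
Unset Printing Implicit Defensive.
Import GRing.Theory.
Local Open Scope ring_scope.
Local Open Scope quotient_scope.

(* C_2-Tambara functors in Lewis-diagram form: the bispan axioms for C_2 are   *)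
(* equivalent to the listed identities.  [lvl_e] is the value at C_2/e,        *)
(* [lvl_C] the value at C_2/C_2, and [weyl] the Weyl action of tau on [lvl_e]. *)
(* The zero ring is allowed, hence [comPzRingType].                            *)
Record tambara := Tambara {
  lvl_e : comPzRingType;
  lvl_C : comPzRingType;
  weyl : {rmorphism lvl_e -> lvl_e};
  res : {rmorphism lvl_C -> lvl_e};
  tr : {additive lvl_e -> lvl_C};
  norm : lvl_e -> lvl_C;
  weylK : forall a, weyl (weyl a) = a;
  weyl_res : forall b, weyl (res b) = res b;
  tr_weyl : forall a, tr (weyl a) = tr a;
  res_tr : forall a, res (tr a) = a + weyl a;
  frobenius : forall a b, tr (a * res b) = tr a * b;
  norm0 : norm 0 = 0;
  norm1 : norm 1 = 1;
  normM : forall a b, norm (a * b) = norm a * norm b;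
  norm_weyl : forall a, norm (weyl a) = norm a;
  res_norm : forall a, res (norm a) = a * weyl a;
  normD : forall a b, norm (a + b) = norm a + norm b + tr (a * weyl b)
}.
Arguments weyl {t}.
Arguments res {t}.
Arguments tr {t}.
Arguments norm {t}.

Record mor (S T : tambara) := Mor {
  mor_e : {rmorphism lvl_e S -> lvl_e T};
  mor_C : {rmorphism lvl_C S -> lvl_C T};
  mor_weyl : forall a, mor_e (weyl a) = weyl (mor_e a);
  mor_res : forall b, mor_e (res b) = res (mor_C b);
  mor_tr : forall a, mor_C (tr a) = tr (mor_e a);
  mor_norm : forall a, mor_C (norm a) = norm (mor_e a)
}.

Definition mor_eq S T (f g : mor S T) : Prop :=
  (forall a, mor_e f a = mor_e g a) /\ (forall b, mor_C f b = mor_C g b).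
Notation "f =T g" := (mor_eq f g) (at level 70, no associativity).

Definition mor_id T : mor T T.
Proof. by exists idfun idfun. Defined.

Definition mor_comp R S T (g : mor S T) (f : mor R S) : mor R T.
Proof.
exists (mor_e g \o mor_e f) (mor_C g \o mor_C f) => x /=.
- by rewrite !mor_weyl.
- by rewrite !mor_res.
- by rewrite !mor_tr.
- by rewrite !mor_norm.
Defined.
Notation "g \oT f" := (mor_comp g f) (at level 50, left associativity).

Definition is_iso S T (f : mor S T) : Prop :=
  exists g : mor T S, g \oT f =T mor_id S /\ f \oT g =T mor_id T.

Definition is_mono S T (f : mor S T) : Prop :=
  forall R (u v : mor R S), f \oT u =T f \oT v -> u =T v.

(* Relative box product S box_R T.  For (commutative) R-algebras in Tambara    *)
(* functors it is the pushout of S <- R -> T in the category of Tambara        *)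
(* functors; the structure below is such a pushout.                            *)
Record rel_box R S T (f : mor R S) (g : mor R T) := RelBox {
  box :> tambara;
  box_inl : mor S box;
  box_inr : mor T box;
  box_comm : box_inl \oT f =T box_inr \oT g;
  box_desc : forall U (u : mor S U) (v : mor T U),
    u \oT f =T v \oT g -> mor box U;
  box_desc_inl : forall U (u : mor S U) (v : mor T U) (uv : u \oT f =T v \oT g),
    box_desc uv \oT box_inl =T u;
  box_desc_inr : forall U (u : mor S U) (v : mor T U) (uv : u \oT f =T v \oT g),
    box_desc uv \oT box_inr =T v;
  box_uniq : forall U (p q : mor box U),
    p \oT box_inl =T q \oT box_inl -> p \oT box_inr =T q \oT box_inr -> p =T q
}.

(* An action of C_2 on T by R-algebra maps, given by the action of tau. *)
Record alg_action R T (eta : mor R T) := AlgAction {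
  act :> mor T T;
  act_invol : act \oT act =T mor_id T;
  act_linear : act \oT eta =T eta
}.

Section FixedRing.
Variables (R : comPzRingType) (s : {rmorphism R -> R}).

Definition fixed_by : {pred R} := [pred x | s x == x].

Fact fixed_by_subring : subring_closed fixed_by.
Proof.
split=> [|x y|x y]; rewrite !inE ?rmorph1 // => /eqP sx /eqP sy.
  by rewrite rmorphB sx sy.
by rewrite rmorphM sx sy.
Qed.

Record fixed_ring := FixedRing { fixed_val :> R; _ : fixed_val \in fixed_by }.
HB.instance Definition _ := [isSub for fixed_val].
HB.instance Definition _ := [Choice of fixed_ring by <:].
HB.instance Definition _ := GRing.SubChoice_isSubComPzRing.Build
  R fixed_by fixed_ring fixed_by_subring.
End FixedRing.

Section FixedMap.
Variables (R S : comPzRingType) (s : {rmorphism R -> R}) (s' : {rmorphism S -> S}).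
Variable f : R -> S.
Hypothesis fs : forall x, f (s x) = s' (f x).

Fact fixed_map_subproof (x : fixed_ring s) : f (val x) \in fixed_by s'.
Proof. by rewrite inE -fs (eqP (valP x)). Qed.

Definition fixed_map (x : fixed_ring s) : fixed_ring s' :=
  FixedRing (fixed_map_subproof x).

Lemma val_fixed_map x : val (fixed_map x) = f (val x).
Proof. by []. Qed.
End FixedMap.

Section FixedMorphism.
Variables (R S : comPzRingType) (s : {rmorphism R -> R}) (s' : {rmorphism S -> S}).

Fact fixed_map_zmod (f : {additive R -> S}) (fs : forall x, f (s x) = s' (f x)) :
  zmod_morphism (fixed_map fs).
Proof. by move=> x y; apply: val_inj; rewrite /= raddfB. Qed.

Fact fixed_map_monoid (f : {rmorphism R -> S}) (fs : forall x, f (s x) = s' (f x)) :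
  monoid_morphism (fixed_map fs).
Proof.
by split=> [|x y]; apply: val_inj; rewrite /= ?rmorph1 ?rmorphM.
Qed.

Definition fixed_additive (f : {additive R -> S})
    (fs : forall x, f (s x) = s' (f x)) :
    {additive fixed_ring s -> fixed_ring s'} :=
  HB.pack (fixed_map fs)
    (GRing.isZmodMorphism.Build _ _ (fixed_map fs) (fixed_map_zmod fs)).

Definition fixed_rmorphism (f : {rmorphism R -> S})
    (fs : forall x, f (s x) = s' (f x)) :
    {rmorphism fixed_ring s -> fixed_ring s'} :=
  HB.pack (fixed_map fs)
    (GRing.isZmodMorphism.Build _ _ (fixed_map fs) (fixed_map_zmod fs))
    (GRing.isMonoidMorphism.Build _ _ (fixed_map fs) (fixed_map_monoid fs)).
End FixedMorphism.

(* Levelwise fixed points T^{C_2}, where s is the action of tau on T.          *)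
Definition fixedT T (s : mor T T) : tambara.
Proof.
refine (@Tambara (fixed_ring (mor_e s)) (fixed_ring (mor_C s))
  (fixed_rmorphism (fun a => esym (mor_weyl s a)))
  (fixed_rmorphism (fun b => esym (mor_res s b)))
  (fixed_additive (fun a => esym (mor_tr s a)))
  (fixed_map (fun a => esym (mor_norm s a)))
  _ _ _ _ _ _ _ _ _ _ _) => *; apply: val_inj => /=.
- exact: weylK.
- exact: weyl_res.
- exact: tr_weyl.
- exact: res_tr.
- exact: frobenius.
- exact: norm0.
- exact: norm1.
- exact: normM.
- exact: norm_weyl.
- exact: res_norm.
- exact: normD.
Defined.

Definition fixed_val_rmorphism (R : comPzRingType) (s : {rmorphism R -> R}) :
  {rmorphism fixed_ring s -> R} := (val : fixed_ring s -> R).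

Definition fixed_incl T (s : mor T T) : mor (fixedT s) T.
Proof.
by refine (@Mor (fixedT s) T (fixed_val_rmorphism (mor_e s))
                            (fixed_val_rmorphism (mor_C s)) _ _ _ _).
Defined.

Section PairMorphism.
Variables (R S T : comPzRingType).

Definition pair_map (f : R -> S) (g : R -> T) (x : R) : S * T := (f x, g x).

Fact pair_map_zmod (f : {additive R -> S}) (g : {additive R -> T}) :
  zmod_morphism (pair_map f g).
Proof. by move=> x y; rewrite /pair_map !raddfB. Qed.

Fact pair_map_monoid (f : {rmorphism R -> S}) (g : {rmorphism R -> T}) :
  monoid_morphism (pair_map f g).
Proof. by split=> [|x y]; rewrite /pair_map ?rmorph1 ?rmorphM. Qed.

Definition pair_additive (f : {additive R -> S}) (g : {additive R -> T}) :
    {additive R -> (S * T)%type} :=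
  HB.pack (pair_map f g)
    (GRing.isZmodMorphism.Build _ _ (pair_map f g) (pair_map_zmod f g)).

Definition pair_rmorphism (f : {rmorphism R -> S}) (g : {rmorphism R -> T}) :
    {rmorphism R -> (S * T)%type} :=
  HB.pack (pair_map f g)
    (GRing.isZmodMorphism.Build _ _ (pair_map f g) (pair_map_zmod f g))
    (GRing.isMonoidMorphism.Build _ _ (pair_map f g) (pair_map_monoid f g)).
End PairMorphism.

Definition prod_tambara (S T : tambara) : tambara.
Proof.
refine (@Tambara (lvl_e S * lvl_e T)%type (lvl_C S * lvl_C T)%type
  (pair_rmorphism (weyl \o fst) (weyl \o snd))
  (pair_rmorphism (res \o fst) (res \o snd))
  (pair_additive (tr \o fst) (tr \o snd))
  (pair_map (norm \o fst) (norm \o snd))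
  _ _ _ _ _ _ _ _ _ _ _) => *; apply: injective_projections => /=.
- exact: weylK.
- exact: weylK.
- exact: weyl_res.
- exact: weyl_res.
- exact: tr_weyl.
- exact: tr_weyl.
- exact: res_tr.
- exact: res_tr.
- exact: frobenius.
- exact: frobenius.
- exact: norm0.
- exact: norm0.
- exact: norm1.
- exact: norm1.
- exact: normM.
- exact: normM.
- exact: norm_weyl.
- exact: norm_weyl.
- exact: res_norm.
- exact: res_norm.
- exact: normD.
- exact: normD.
Defined.

Definition mor_pair R S T (f : mor R S) (g : mor R T) : mor R (prod_tambara S T).
Proof.
exists (pair_rmorphism (mor_e f) (mor_e g)) (pair_rmorphism (mor_C f) (mor_C g));
  move=> x; rewrite /= /pair_map /=.
- by rewrite !mor_weyl.
- by rewrite !mor_res.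
- by rewrite !mor_tr.
- by rewrite !mor_norm.
Defined.

Section Galois.
Variables (R T : tambara) (eta : mor R T) (P : rel_box eta eta).

Definition box_mul : mor P T := @box_desc _ _ _ _ _ P T (mor_id T) (mor_id T)
  (conj (fun _ => erefl) (fun _ => erefl)).

Fact box_id_act_subproof (h : alg_action eta) :
  box_inl P \oT eta =T (box_inr P \oT h) \oT eta.
Proof.
have [lin_e lin_C] := act_linear h; have [comm_e comm_C] := box_comm P.
split=> a.
  by rewrite [LHS]comm_e /=; congr (mor_e _ _); rewrite -[LHS]lin_e.
by rewrite [LHS]comm_C /=; congr (mor_C _ _); rewrite -[LHS]lin_C.
Qed.

(* id box_R h *)
Definition box_id_act (h : alg_action eta) : mor P P :=
  box_desc P (box_id_act_subproof h).

Definition alg_action1 : alg_action eta.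
Proof. by exists (mor_id T). Defined.

(* The product over C_2 is ordered as (1, tau), and s is the action of tau. *)
Definition galois_map (s : alg_action eta) : mor P (prod_tambara T T) :=
  mor_pair (box_mul \oT box_id_act alg_action1) (box_mul \oT box_id_act s).
End Galois.

Record galois R T (eta : mor R T) (s : alg_action eta) : Prop := Galois {
  galois_mono : is_mono eta;
  galois_fixed : exists f : mor R (fixedT s),
    is_iso f /\ fixed_incl s \oT f =T eta;
  galois_box : forall P : rel_box eta eta, is_iso (galois_map P s)
}.

Definition two_invertible T : Prop :=
  (exists u : lvl_e T, 2%:R * u = 1) /\ (exists u : lvl_C T, 2%:R * u = 1).

(* T[1/2], by its universal property among Tambara functors. *)
Record inv_two T := InvTwo {
  loc :> tambara;
  loc_map : mor T loc;
  loc_two : two_invertible loc;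
  loc_desc : forall U (f : mor T U), two_invertible U -> mor loc U;
  loc_descE : forall U (f : mor T U) (U2 : two_invertible U),
    loc_desc f U2 \oT loc_map =T f;
  loc_uniq : forall U (p q : mor loc U),
    p \oT loc_map =T q \oT loc_map -> p =T q
}.

Section PrincipalIdeal.
Variables (R : comNzRingType) (g : R).

Definition princ : {pred R} := [pred p | `[< exists c, p = c * g >]].

Lemma princP p : reflect (exists c, p = c * g) (p \in princ).
Proof. by rewrite inE; apply: asboolP. Qed.

Lemma princ_gen : g \in princ.
Proof. by apply/princP; exists 1; rewrite mul1r. Qed.

Fact princ_idealr : 1 \notin princ -> idealr_closed princ.
Proof.
move=> g1; split=> // [|a p q]; first by apply/princP; exists 0; rewrite mul0r.
move=> /princP[b ->] /princP[c ->]; apply/princP; exists (a * b + c).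
by rewrite mulrDl mulrA.
Qed.
End PrincipalIdeal.

Section QuotientLift.
Variables (R : comNzRingType) (I : idealr R) (S : comNzRingType).
Variables (f : {rmorphism R -> S}) (f0 : forall p, p \in (I : {pred R}) -> f p = 0).

Definition quot_lift (z : {ideal_quot I}) : S := f (repr z).

Lemma quot_liftE p : quot_lift (\pi p) = f p.
Proof.
apply/eqP; rewrite -subr_eq0 -rmorphB; apply/eqP/f0.
by rewrite Quotient.idealrBE reprK.
Qed.

Fact quot_lift_zmod : zmod_morphism quot_lift.
Proof.
move=> y z; rewrite -[y]reprK -[z]reprK -rmorphB !quot_liftE.
by rewrite rmorphB.
Qed.

Fact quot_lift_monoid : monoid_morphism quot_lift.
Proof.
split=> [|y z]; first by rewrite -(rmorph1 (\pi_{ideal_quot I})) quot_liftE rmorph1.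
rewrite -[y]reprK -[z]reprK -rmorphM !quot_liftE.
by rewrite rmorphM.
Qed.

Definition quot_lift_rmorphism : {rmorphism {ideal_quot I} -> S} :=
  HB.pack quot_lift
    (GRing.isZmodMorphism.Build _ _ quot_lift quot_lift_zmod)
    (GRing.isMonoidMorphism.Build _ _ quot_lift quot_lift_monoid).
End QuotientLift.

(* The Burnside Tambara functor: Z at C_2/e and Z[t]/(t^2 - 2t) at C_2/C_2. *)
Definition burn_rel : {poly int} := 'X^2 - 2%:R *: 'X.
Definition burn_ideal : {pred {poly int}} := princ burn_rel.

Fact burn_ideal1 : 1 \notin burn_ideal.
Proof.
apply/princP => -[c /(congr1 (horner^~ 0))].
by rewrite !hornerE.
Qed.
HB.instance Definition _ :=
  isIdealr.Build {poly int} burn_ideal (princ_idealr burn_ideal1).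

Definition burn_C : comNzRingType := {ideal_quot burn_ideal}.
Definition burn_pi : {rmorphism {poly int} -> burn_C} :=
  \pi_{ideal_quot burn_ideal}.
Definition burn_t : burn_C := burn_pi 'X.

Lemma burn_tt : burn_t * burn_t = 2%:R * burn_t.
Proof.
rewrite /burn_t -[2%:R](rmorph_nat burn_pi) -!rmorphM.
apply/eqP; rewrite -Quotient.idealrBE; apply/princP; exists 1.
by rewrite mul1r /burn_rel expr2 scaler_nat mulr_natl.
Qed.

Definition burn_res_poly : {rmorphism {poly int} -> int} := horner_eval 2%:R.

Fact burn_res_ideal p : p \in burn_ideal -> burn_res_poly p = 0.
Proof.
case/princP=> c ->; rewrite rmorphM /=.
by rewrite /horner_eval !hornerE.
Qed.

Definition burn_res : {rmorphism burn_C -> int} :=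
  quot_lift_rmorphism burn_res_ideal.

Lemma burn_res_t : burn_res burn_t = 2.
Proof. by rewrite [LHS](quot_liftE burn_res_ideal) /= /horner_eval hornerX. Qed.

Definition burn_tr (a : int) : burn_C := burn_t * a%:~R.

Fact burn_tr_zmod : zmod_morphism burn_tr.
Proof. by move=> a b; rewrite /burn_tr rmorphB mulrBr. Qed.
HB.instance Definition _ := GRing.isZmodMorphism.Build int burn_C burn_tr burn_tr_zmod.

(* norm(a) = a + (a^2 - a)/2 t, the class of the C_2-set of maps C_2 -> {1..a} *)
(* for a >= 0; in particular norm(-1) = t - 1.                                 *)
Definition half_bin (a : int) : int := ((a ^+ 2 - a) %/ 2)%Z.
Definition burn_norm (a : int) : burn_C := a%:~R + burn_t * (half_bin a)%:~R.

Lemma half_binE a : 2 * half_bin a = a ^+ 2 - a.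
Proof.
rewrite mulrC divzK //; case: (intP a) => [//|n|n].
  rewrite expr2 -[X in _ - X]mulr1 -mulrBr -addn1 PoszD addrK -PoszM.
  by rewrite dvdzE /= dvdn2 oddM oddD addbT /= andNb.
rewrite sqrrN opprK expr2 -PoszM -PoszD.
by rewrite dvdzE /= dvdn2 oddD oddM andbb addbb.
Qed.

Lemma half_binD a b : half_bin (a + b) = half_bin a + half_bin b + a * b.
Proof.
apply: (@mulfI _ 2) => //; rewrite !mulrDr !half_binE; ring.
Qed.

Lemma half_binM a b :
  half_bin (a * b) = a * half_bin b + b * half_bin a + 2 * half_bin a * half_bin b.
Proof.
apply: (@mulfI _ 2) => //; rewrite [LHS]half_binE.
move: (half_binE a) (half_binE b); set u := half_bin a; set v := half_bin b => Hu Hv.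
transitivity (a * (2 * v) + b * (2 * u)
              + (2 * u) * (2 * v)); last by ring.
rewrite Hu Hv; ring.
Qed.

Lemma burn_norm0 : burn_norm 0 = 0.
Proof. by rewrite /burn_norm /half_bin /= mulr0 addr0. Qed.

Lemma burn_norm1 : burn_norm 1 = 1.
Proof. by rewrite /burn_norm /half_bin /= mulr0 addr0. Qed.

Lemma burn_normN1 : burn_norm (- 1) = burn_t - 1.
Proof. by rewrite /burn_norm /half_bin /= mulr1 addrC. Qed.

Lemma burn_normD a b :
  burn_norm (a + b) = burn_norm a + burn_norm b + burn_tr (a * b).
Proof. rewrite /burn_norm /burn_tr half_binD !rmorphD /=; ring. Qed.

Lemma burn_normM a b : burn_norm (a * b) = burn_norm a * burn_norm b.
Proof.
rewrite /burn_norm half_binM !rmorphD !rmorphM /=.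
set x := a%:~R; set y := b%:~R; set u := _%:~R; set v := _%:~R.
have -> : (x + burn_t * v) * (y + burn_t * u) =
  x * y + burn_t * (x * u + y * v) + (burn_t * burn_t) * (u * v) by ring.
rewrite burn_tt; ring.
Qed.

Lemma burn_res_norm a : burn_res (burn_norm a) = a * a.
Proof.
rewrite rmorphD rmorphM !rmorph_int burn_res_t !intz half_binE; ring.
Qed.

Lemma burn_res_tr a : burn_res (burn_tr a) = a + a.
Proof.
by rewrite /burn_tr rmorphM burn_res_t rmorph_int intz mulr_natl.
Qed.

Lemma burn_CP (z : burn_C) : exists a b : int, z = a%:~R + burn_t * b%:~R.
Proof.
rewrite -[z]reprK; rewrite -[\pi _]/(burn_pi _); elim/poly_ind: (repr z) => [|p c [a [b pE]]].
  by exists 0, 0; rewrite !rmorph0 mulr0 addr0.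
exists c, (a + 2 * b); have cE : burn_pi c%:P = c%:~R by rewrite -[c in LHS]intz !rmorph_int.
rewrite rmorphD [burn_pi (p * _)]rmorphM pE cE -/burn_t rmorphD rmorphM /= mulrDl -mulrA.
have -> : burn_t * (b%:~R * burn_t) = burn_t * burn_t * b%:~R by ring.
rewrite burn_tt; ring.
Qed.

Lemma burn_frobenius a b : burn_tr (a * burn_res b) = burn_tr a * b.
Proof.
have [u [v ->]] := burn_CP b.
rewrite rmorphD rmorphM burn_res_t !rmorph_int !intz /burn_tr.
have -> : burn_t * a%:~R * (u%:~R + burn_t * v%:~R) =
  burn_t * a%:~R * u%:~R + burn_t * burn_t * (a%:~R * v%:~R) by ring.
rewrite burn_tt !(rmorphM, rmorphD) /=; ring.
Qed.

Definition burnsideT : tambara :=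
  @Tambara int burn_C idfun burn_res burn_tr burn_norm
    (fun=> erefl) (fun=> erefl) (fun=> erefl) burn_res_tr burn_frobenius
    burn_norm0 burn_norm1 burn_normM (fun=> erefl) burn_res_norm burn_normD.

(* The free Tambara functor A[x_{C_2/C_2}]: Z[x] at C_2/e, with trivial Weyl   *)
(* action, and A(C_2/C_2)[x_*][n_*]/(t n_* - t x_*^2) at C_2/C_2.  In          *)
(* [{poly {poly burn_C}}] the inner variable is x_*, the outer one n_*.        *)
Definition free_rel : {poly {poly burn_C}} :=
  burn_t%:P%:P * 'X - (burn_t%:P * 'X^2)%:P.
Definition free_ideal : {pred {poly {poly burn_C}}} := princ free_rel.

Fact free_ideal1 : 1 \notin free_ideal.
Proof.
apply/princP => -[c /(congr1 (fun p => p.[0].[0])) /eqP].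
by rewrite !hornerE /= mulr0 oppr0 mulr0 oner_eq0.
Qed.
HB.instance Definition _ :=
  isIdealr.Build {poly {poly burn_C}} free_ideal (princ_idealr free_ideal1).

Definition free_C : comNzRingType := {ideal_quot free_ideal}.
Definition free_pi : {rmorphism {poly {poly burn_C}} -> free_C} :=
  \pi_{ideal_quot free_ideal}.
Definition free_scal : {rmorphism burn_C -> free_C} :=
  free_pi \o polyC \o polyC.
Definition free_t : free_C := free_scal burn_t.
Definition free_x : free_C := free_pi 'X%:P.
Definition free_n : free_C := free_pi 'X.

Lemma free_tt : free_t * free_t = 2%:R * free_t.
Proof. by rewrite -rmorphM burn_tt rmorphM rmorph_nat. Qed.

Lemma free_tn : free_t * free_n = free_t * free_x ^+ 2.
Proof.
rewrite -[free_t]/(free_pi burn_t%:P%:P) /free_n /free_x.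
rewrite -(rmorphXn free_pi) -!(rmorphM free_pi).
apply/eqP; rewrite -Quotient.idealrBE.
have -> : burn_t%:P%:P * 'X - burn_t%:P%:P * 'X%:P ^+ 2 = free_rel.
  by rewrite /free_rel polyCM polyC_exp.
exact: princ_gen.
Qed.

Section PolyEval.
Variables (R S : comNzRingType) (f : {rmorphism R -> S}) (q : {poly S}).

(* coefficients by f, inner variable to 'X, outer variable to q *)
Definition poly_eval : {rmorphism {poly {poly R}} -> {poly S}} :=
  horner_eval q \o map_poly (map_poly f).

Lemma poly_evalC c : poly_eval c%:P%:P = (f c)%:P.
Proof. by rewrite /= /horner_eval map_polyC hornerC /= map_polyC. Qed.

Lemma poly_evalx : poly_eval 'X%:P = 'X.
Proof. by rewrite /= /horner_eval map_polyC hornerC /= map_polyX. Qed.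

Lemma poly_evaln : poly_eval 'X = q.
Proof. by rewrite /= /horner_eval map_polyX hornerX. Qed.
End PolyEval.

Definition free_res_poly := poly_eval burn_res 'X^2.

Fact free_res_ideal P : P \in free_ideal -> free_res_poly P = 0.
Proof.
case/princP=> c ->; rewrite (rmorphM free_res_poly).
rewrite [free_res_poly free_rel](_ : _ = 0) ?mulr0 //.
rewrite /free_rel polyCM polyC_exp (rmorphB free_res_poly).
rewrite !(rmorphM free_res_poly).
by rewrite poly_evalC poly_evalx poly_evaln subrr.
Qed.

Definition free_res : {rmorphism free_C -> {poly int}} :=
  quot_lift_rmorphism free_res_ideal.

Lemma free_res_pi P : free_res (free_pi P) = free_res_poly P.
Proof. exact: (quot_liftE free_res_ideal). Qed.

Lemma free_res_scal a : free_res (free_scal a) = (burn_res a)%:P.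
Proof. by rewrite free_res_pi poly_evalC. Qed.

Lemma free_res_x : free_res free_x = 'X.
Proof. by rewrite free_res_pi poly_evalx. Qed.

Lemma free_res_n : free_res free_n = 'X^2.
Proof. by rewrite free_res_pi poly_evaln. Qed.

(* p(x) |-> p(x_ * ) *)
Definition free_emb : {rmorphism {poly int} -> free_C} :=
  free_pi \o polyC \o map_poly intr.

Lemma free_embX : free_emb 'X = free_x.
Proof. by rewrite /free_emb /= map_polyX. Qed.

Lemma free_embC c : free_emb c%:P = c%:~R.
Proof. by rewrite -[c in LHS]intz !rmorph_int. Qed.

Lemma free_res_emb p : free_res (free_emb p) = p.
Proof.
elim/poly_ind: p => [|p c IHp]; first by rewrite !rmorph0.
rewrite rmorphD [free_emb (p * _)]rmorphM free_embX free_embC.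
by rewrite rmorphD [free_res (_ * _)]rmorphM IHp free_res_x -free_embC
  free_embC rmorph_int -[in RHS](intz c) rmorph_int.
Qed.

Definition free_tr (p : {poly int}) : free_C := free_t * free_emb p.

Fact free_tr_zmod : zmod_morphism free_tr.
Proof. by move=> p q; rewrite /free_tr rmorphB mulrBr. Qed.
HB.instance Definition _ :=
  GRing.isZmodMorphism.Build {poly int} free_C free_tr free_tr_zmod.

(* The only norm with norm(c) as in the Burnside functor and norm(x) = n_*:    *)
(* norm(c + x p) = norm(c) + n_* norm(p) + tr(c x p).                          *)
Fixpoint free_norm_seq (s : seq int) : free_C :=
  if s is c :: s' then
    free_scal (burn_norm c) + free_n * free_norm_seq s'
      + free_tr (c%:P * ('X * Poly s'))
  else 0.
Definition free_norm (p : {poly int}) : free_C := free_norm_seq p.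

Lemma free_norm0 : free_norm 0 = 0.
Proof. by rewrite /free_norm polyseq0. Qed.

Lemma free_tr_cX0 c : free_tr (c%:P * ('X * 0)) = 0.
Proof. by rewrite [_ * (_ * 0)](_ : _ = 0) ?raddf0 // !mulr0. Qed.

Lemma free_normC c : free_norm c%:P = free_scal (burn_norm c).
Proof.
rewrite /free_norm polyseqC; case: eqP => [->|_] /=.
  by rewrite burn_norm0 rmorph0.
by rewrite [free_n * 0]mulr0 free_tr_cX0 !addr0.
Qed.

Lemma free_norm_rec p c : free_norm (p * 'X + c%:P) =
  free_scal (burn_norm c) + free_n * free_norm p + free_tr (c%:P * ('X * p)).
Proof.
have [->|p0] := eqVneq p 0.
  rewrite mul0r add0r free_normC free_norm0.
  by rewrite [free_n * 0]mulr0 free_tr_cX0 !addr0.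
rewrite /free_norm -cons_poly_def polyseq_cons nil_poly p0 /=.
by rewrite polyseqK.
Qed.

Lemma free_norm1 : free_norm 1 = 1.
Proof. by rewrite free_normC burn_norm1 rmorph1. Qed.

Lemma free_norm_mulX p : free_norm (p * 'X) = free_n * free_norm p.
Proof.
by rewrite -[p * 'X]addr0 free_norm_rec burn_norm0 rmorph0 add0r mul0r raddf0 addr0.
Qed.

Lemma free_normX : free_norm 'X = free_n.
Proof. by rewrite -['X]mul1r free_norm_mulX free_norm1 mulr1. Qed.

Lemma free_scal_norm c :
  free_scal (burn_norm c) = c%:~R + free_t * (half_bin c)%:~R.
Proof. by rewrite rmorphD rmorphM !rmorph_int. Qed.

Lemma free_t_norm p : free_t * free_norm p = free_t * free_emb p ^+ 2.
Proof.
elim/poly_ind: p => [|p c IHp]; first by rewrite free_norm0 rmorph0 expr2 !mulr0.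
rewrite free_norm_rec free_scal_norm /free_tr.
rewrite !(rmorphD free_emb) !(rmorphM free_emb) free_embX free_embC.
set P := free_emb p in IHp *; set N := free_norm p in IHp *.
transitivity (free_t * c%:~R + (free_t * free_t) * (half_bin c)%:~R
  + (free_t * free_n) * N + (free_t * free_t) * (c%:~R * (free_x * P))); first by ring.
rewrite free_tt free_tn.
transitivity (free_t * (c%:~R + (2 * half_bin c)%:~R) + free_x ^+ 2 * (free_t * N)
  + 2%:R * free_t * (c%:~R * (free_x * P))); first by rewrite rmorphM /=; ring.
rewrite IHp half_binE rmorphB rmorphXn /=; ring.
Qed.

Lemma free_normD p q :
  free_norm (p + q) = free_norm p + free_norm q + free_tr (p * q).
Proof.
elim/poly_ind: p q => [|p a IHp] q; first by rewrite mul0r raddf0 add0r free_norm0 add0r addr0.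
elim/poly_ind: q => [|q b _]; first by rewrite mulr0 raddf0 !addr0 free_norm0 addr0.
have -> : p * 'X + a%:P + (q * 'X + b%:P) = (p + q) * 'X + (a + b)%:P.
  by rewrite polyCD; ring.
rewrite !free_norm_rec IHp burn_normD /free_tr.
rewrite !(rmorphD free_emb, rmorphM free_emb, rmorphD free_scal) free_embX !free_embC.
rewrite /burn_tr rmorphM -/free_t rmorph_int !intrD intrM.
set P := free_emb p; set Q := free_emb q; set N := free_norm p; set M := free_norm q.
have -> : free_n * (N + M + free_t * (P * Q)) =
  free_n * (N + M) + free_t * free_n * (P * Q) by ring.
rewrite free_tn; ring.
Qed.

Lemma free_normCM c q : free_norm (c%:P * q) = free_norm c%:P * free_norm q.
Proof.
have := free_t_norm c%:P; rewrite free_normC free_embC => tC.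
elim/poly_ind: q => [|q b IHq]; first by rewrite [c%:P * 0]mulr0 free_norm0 mulr0.
have -> : c%:P * (q * 'X + b%:P) = (c%:P * q) * 'X + (c * b)%:P.
  by rewrite polyCM; ring.
rewrite !free_norm_rec IHq burn_normM /free_tr.
rewrite (rmorphM free_scal) !(rmorphM free_emb) !free_embC free_embX intrM.
move: (free_scal (burn_norm b)) (free_emb q) (free_norm q) => B Q M.
move: tC; move: (free_scal (burn_norm c)) => C.
move: free_t free_n free_x (c%:~R) (b%:~R) => t n x c' b' tC.
transitivity (C * (B + n * M) + t * C * (b' * (x * Q))); last by ring.
rewrite tC; ring.
Qed.

Lemma free_normM p q : free_norm (p * q) = free_norm p * free_norm q.
Proof.
elim/poly_ind: p => [|p c IHp]; first by rewrite mul0r free_norm0 mul0r.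
have -> : (p * 'X + c%:P) * q = (p * q) * 'X + c%:P * q by ring.
rewrite free_normD free_norm_mulX IHp free_normCM free_norm_rec -free_normC /free_tr.
rewrite !(rmorphM free_emb) !free_embC free_embX.
have := free_t_norm q.
move: (free_emb p) (free_emb q) (free_norm p) (free_norm q) (free_norm c%:P).
move=> P Q N M C; move: free_t free_n free_x (c%:~R) => t n x c' tM.
transitivity (C * M + n * N * M + t * M * (c' * (x * P))); last by ring.
rewrite tM; ring.
Qed.

Lemma free_res_t : free_res free_t = 2%:R.
Proof. by rewrite free_res_scal burn_res_t rmorph_nat. Qed.

Lemma free_res_tr p : free_res (free_tr p) = p + p.
Proof. by rewrite rmorphM free_res_t free_res_emb mulr_natl. Qed.

Lemma free_res_norm p : free_res (free_norm p) = p * p.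
Proof.
elim/poly_ind: p => [|p c IHp]; first by rewrite free_norm0 rmorph0 mul0r.
rewrite free_norm_rec !(rmorphD free_res) free_res_scal burn_res_norm.
rewrite (rmorphM free_res) free_res_n IHp free_res_tr polyCM; ring.
Qed.

Lemma free_t_res z : free_t * free_emb (free_res z) = free_t * z.
Proof.
pose K y := free_t * free_emb (free_res y) = free_t * y.
have KD y y' : K y -> K y' -> K (y + y').
  by rewrite /K rmorphD (rmorphD free_emb) !mulrDr => -> ->.
have KM y y' : K y -> K y' -> K (y * y').
  rewrite /K rmorphM (rmorphM free_emb).
  move: (free_emb _) (free_emb _) free_t => u u' t Ku Ku'.
  by rewrite mulrA Ku -mulrA mulrCA Ku' mulrCA.
have Kscal a : K (free_scal a).
  have [u [v ->]] := burn_CP a.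
  rewrite /K free_res_scal rmorphD (rmorphM burn_res) burn_res_t !rmorph_int !intz.
  rewrite free_embC intrD intrM (rmorphD free_scal) (rmorphM free_scal) !rmorph_int.
  rewrite -/free_t; have := free_tt.
  move: free_t (u%:~R) (v%:~R) => t u' v' tt.
  transitivity (t * u' + 2%:R * t * v'); first by ring.
  by rewrite -tt; ring.
have Kx : K free_x by rewrite /K free_res_x free_embX.
have Kn : K free_n by rewrite /K free_res_n rmorphXn free_embX free_tn.
have Kp (p : {poly burn_C}) : K (free_pi p%:P).
  elim/poly_ind: p => [|p c IHp]; first by rewrite /K !rmorph0.
  by rewrite polyCD polyCM rmorphD rmorphM; apply: KD (Kscal c); apply: KM.
rewrite -[z]reprK -[\pi _]/(free_pi _).
elim/poly_ind: (repr z) => [|P p IHP]; first by rewrite /K !rmorph0.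
by rewrite (rmorphD free_pi) (rmorphM free_pi); apply: KD (Kp p); apply: KM.
Qed.

Lemma free_frobenius p z : free_tr (p * free_res z) = free_tr p * z.
Proof.
rewrite /free_tr rmorphM mulrCA free_t_res; ring.
Qed.

Definition freeT : tambara :=
  @Tambara {poly int} free_C idfun free_res free_tr free_norm
    (fun=> erefl) (fun=> erefl) (fun=> erefl) free_res_tr free_frobenius
    free_norm0 free_norm1 free_normM (fun=> erefl) free_res_norm free_normD.

(* The unit A -> A[x_{C_2/C_2}]. *)
Lemma free_scal_tr a : free_scal (burn_tr a) = free_tr a%:P.
Proof. by rewrite /burn_tr /free_tr rmorphM rmorph_int free_embC. Qed.

Definition free_unit : mor burnsideT freeT :=
  @Mor burnsideT freeT (polyC : {rmorphism int -> {poly int}}) free_scal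
    (fun=> erefl) (fun b => esym (free_res_scal b)) free_scal_tr
    (fun a => esym (free_normC a)).

(* Grading on A[x_{C_2/C_2}]: |x| = |x_*| = 1, |n_*| = 2, |t| = 0.             *)
Definition homog_e (d : nat) (p : lvl_e freeT) : Prop :=
  forall i, (p : {poly int})`_i != 0 -> i = d.

Definition homog_C (d : nat) (z : lvl_C freeT) : Prop :=
  exists2 P : {poly {poly burn_C}},
    forall i j, P`_j`_i != 0 -> (i + 2 * j)%N = d & z = free_pi P.

Definition preserves_degree (f : mor freeT freeT) : Prop :=
  forall d, (forall p, homog_e d p -> homog_e d (mor_e f p))
         /\ (forall z, homog_C d z -> homog_C d (mor_C f z)).

Definition doubles_degree (f : mor freeT freeT) : Prop :=
  forall d, (forall p, homog_e d p -> homog_e (2 * d) (mor_e f p))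
         /\ (forall z, homog_C d z -> homog_C (2 * d) (mor_C f z)).

(* Main.v *)
Require Import Defs.
From HB Require Import structures.
From mathcomp Require Import all_boot all_order all_algebra.
From mathcomp Require Import algC.
From mathcomp Require Import ring zify.

Set Implicit Arguments.
Unset Strict Implicit.
Unset Printing Implicit Defensive.
Import GRing.Theory Num.Theory.
Local Open Scope ring_scope.

(** The Burnside functor A is initial, so two morphisms out of G (or out of
    G[1/2]) take the same values on whatever comes from A (or A[1/2]).  Hence
    it is enough to produce a Tambara functor U, with 2 invertible, and two
    morphisms u, v : G -> U that disagree on some element fixed by tau: that
    element cannot come from A, neither before nor after inverting 2.

    The target U is a ghost functor: from a commutative ring R one builds a
    Tambara functor with R at C_2/e and R * R at C_2/C_2, the second factor
    playing the role of geometric fixed points, on which transfers vanish and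
    the norm is the identity of R.  A morphism from the free functor to it is
    given by two elements j and xi, the two components of the image of x_*
    ([free_ghost]); n_* = norm(x) is then sent to (j^2, j).

    Take R to be the algebraic complex numbers and j = i.  Degree reasons give
    phi(y_* ) = a x_*^2 + b n_* with a, b in A(C_2/C_2).  Modulo transfers tau
    sends n_* to norm(-1) n_* = - n_* and scales x_* by an integer d, so
    invariance of phi(y_* ) kills the mark of b, while res(phi(y_* )) = x^2
    makes the mark of a odd ([phi_y_mark]).  The mark of psi(y_* ) is odd too,
    since its restriction is -1.  So the morphism given by (i, xi) factors
    through the pushout G exactly when (mark a) xi^2 = mark (psi(y_* )); this
    equation has two opposite nonzero solutions, and these give u and v
    ([free_ghost_comm]).

    The fixed elements x_* + tau(x_* ) and n_* x_* + tau(n_* x_* ) have second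
    components (1 + d) xi and i (1 - d) xi.  Both are odd in xi, so u and v
    could agree on them only if both vanished, which forces 2 xi = 0
    ([fixed_points_separate]). *)

(** * Uniqueness of morphisms out of A and A[x] *)

Lemma burnsideT_mor_uniq (T : tambara) (p q : mor burnsideT T) : p =T q.
Proof.
have eE a : mor_e p a = mor_e q a by rewrite -[a]intz !rmorph_int.
split=> // b; have [u [v ->]] := burn_CP b.
have tE : burn_t = @tr burnsideT 1 by rewrite /= /burn_tr mulr1.
by rewrite !rmorphD !rmorphM !rmorph_int tE !mor_tr eE.
Qed.

(** Restriction, transfer and norm generate everything from x_* : x is res(x_* ),
    n_* is norm(x), and t is the transfer of 1. *)
Lemma freeT_mor_uniq (T : tambara) (p q : mor freeT T) :
  mor_C p free_x = mor_C q free_x -> p =T q.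
Proof.
move=> xE.
have XE : mor_e p 'X = mor_e q 'X.
  by rewrite -free_res_x; rewrite (mor_res p free_x) (mor_res q free_x) xE.
have eE (a : {poly int}) : mor_e p a = mor_e q a.
  elim/poly_ind: a => [|a c IHa]; first by rewrite !rmorph0.
  have cE : c%:P = c%:~R :> {poly int} by rewrite -[c in LHS]intz rmorph_int.
  by rewrite !rmorphD /= !rmorphM /= IHa XE cE !rmorph_int.
split=> // b.
have nE : mor_C p free_n = mor_C q free_n.
  by rewrite -free_normX (mor_norm p 'X) (mor_norm q 'X) XE.
have scalE c : mor_C p (free_scal c) = mor_C q (free_scal c).
  by have [_ /(_ c)] := @burnsideT_mor_uniq _ (p \oT free_unit) (q \oT free_unit).
have pE (a : {poly burn_C}) : mor_C p (free_pi a%:P) = mor_C q (free_pi a%:P).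
  elim/poly_ind: a => [|a c IHa]; first by rewrite !rmorph0.
  by rewrite polyCD polyCM !(rmorphD, rmorphM) /= IHa xE scalE.
rewrite -[b]generic_quotient.reprK -[X in mor_C p X]/(free_pi _) -[X in mor_C q X]/(free_pi _).
elim/poly_ind: (generic_quotient.repr _) => [|P c IHP]; first by rewrite !rmorph0.
by rewrite !(rmorphD, rmorphM) /= IHP nE pE.
Qed.

(** * Marks: the quotient by transfers *)

Fact burn_mark_ideal p : p \in burn_ideal -> horner_eval (0 : int) p = 0.
Proof. by case/princP=> c ->; rewrite rmorphM /= /horner_eval !hornerE. Qed.

(** The number of C_2-fixed points of a virtual C_2-set; it kills the free
    orbit t, whereas [burn_res] is the underlying cardinality. *)
Definition burn_mark : {rmorphism burn_C -> int} :=
  quot_lift_rmorphism burn_mark_ideal.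

Lemma burn_mark_t : burn_mark burn_t = 0.
Proof. by rewrite [LHS](quot_liftE burn_mark_ideal) /= /horner_eval hornerX. Qed.

(** A finite C_2-set and its fixed points have cardinalities of the same parity. *)
Lemma burn_res_mark b : exists c, burn_res b = burn_mark b + 2 * c.
Proof.
have [u [v ->]] := burn_CP b; exists v.
by rewrite !rmorphD !rmorphM !rmorph_int burn_res_t burn_mark_t !intz mul0r addr0.
Qed.

Lemma burn_mark_neq0 b c : burn_res b = 2 * c + 1 -> burn_mark b != 0.
Proof. by have [d ->] := burn_res_mark b; lia. Qed.

(** With t = 0 the relation t n_* = t x_*^2 becomes void, so x_* and n_* can be
    sent to arbitrary elements xi and nu. *)
Section FreeMark.
Variables (R : comNzRingType) (xi nu : R).

Definition free_mark_poly : {rmorphism {poly {poly burn_C}} -> R} :=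
  horner_eval xi \o poly_eval (intr \o burn_mark) nu%:P.

Lemma free_mark_polyE P :
  free_mark_poly P = (poly_eval (intr \o burn_mark : {rmorphism burn_C -> R}) nu%:P P).[xi].
Proof. by []. Qed.

Lemma free_mark_polyC c : free_mark_poly c%:P%:P = (burn_mark c)%:~R.
Proof. by rewrite free_mark_polyE poly_evalC hornerC. Qed.

Fact free_mark_ideal P : P \in free_ideal -> free_mark_poly P = 0.
Proof.
case/princP=> c ->; rewrite rmorphM /free_rel polyCM rmorphB.
rewrite ![free_mark_poly (_%:P%:P * _)]rmorphM !free_mark_polyC burn_mark_t /=.
by rewrite !mul0r subr0 mulr0.
Qed.

Definition free_mark : {rmorphism free_C -> R} :=
  quot_lift_rmorphism free_mark_ideal.

Lemma free_mark_pi P : free_mark (free_pi P) = free_mark_poly P.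
Proof. exact: (quot_liftE free_mark_ideal). Qed.

Lemma free_mark_scal b : free_mark (free_scal b) = (burn_mark b)%:~R.
Proof. by rewrite free_mark_pi free_mark_polyC. Qed.

Lemma free_mark_t : free_mark free_t = 0.
Proof. by rewrite free_mark_scal burn_mark_t. Qed.

Lemma free_mark_x : free_mark free_x = xi.
Proof. by rewrite free_mark_pi free_mark_polyE poly_evalx hornerX. Qed.

Lemma free_mark_n : free_mark free_n = nu.
Proof. by rewrite free_mark_pi free_mark_polyE poly_evaln hornerC. Qed.

Lemma free_mark_tr p : free_mark (free_tr p) = 0.
Proof. by rewrite rmorphM free_mark_t mul0r. Qed.

(** Modulo transfers the norm is a ring morphism, so it is determined by
    norm(x) = n_*. *)
Lemma free_mark_norm p : free_mark (free_norm p) = (map_poly intr p).[nu].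
Proof.
elim/poly_ind: p => [|p c IHp]; first by rewrite free_norm0 !rmorph0 horner0.
rewrite free_norm_rec !(rmorphD free_mark) (rmorphM free_mark) free_mark_tr addr0.
rewrite free_mark_n IHp free_mark_scal rmorphD rmorphM burn_mark_t mul0r addr0.
rewrite rmorph_int intz rmorphD rmorphM /= map_polyX map_polyC !hornerE.
by rewrite addrC mulrC.
Qed.
End FreeMark.

(** * The ghost Tambara functor of a ring *)

Section Ghost.
Variable R : comPzRingType.

Definition ghost_tr (a : R) : R * R := (a + a, 0).

Fact ghost_tr_zmod : zmod_morphism ghost_tr.
Proof. by move=> a b; congr pair; rewrite /= ?subr0 // opprD addrACA. Qed.
HB.instance Definition _ :=
  GRing.isZmodMorphism.Build R (R * R)%type ghost_tr ghost_tr_zmod.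

(** The second component of the norm must be additive because transfers have no
    second component; the identity is the simplest choice. *)
Definition ghostT : tambara.
Proof.
refine (@Tambara R (R * R)%type idfun fst ghost_tr (fun a => (a * a, a))
  _ _ _ _ _ _ _ _ _ _ _) => //=.
- by move=> a b; congr pair; rewrite /= ?mul0r ?mulrDl.
- by rewrite mul0r.
- by rewrite mul1r.
- by move=> a b; congr pair; rewrite mulrACA.
- by move=> a b; congr pair; rewrite /= ?addr0 //; ring.
Defined.
End Ghost.

Lemma ghostT_two (R : comPzRingType) (h : R) : 2%:R * h = 1 -> two_invertible (ghostT R).
Proof.
move=> hE; split; first by exists h.
exists ((h, h) : (R * R)%type); rewrite mulr_natl.
by apply: injective_projections; rewrite /= -hE mulr_natl.
Qed.

Section FreeGhost.
Variables (R : comNzRingType) (j xi : R).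

(** Sends x_* to (j, xi).  The value of n_* is forced: its second component is
    the one of norm(j), namely j. *)
Definition free_ghost : mor freeT (ghostT R).
Proof.
pose ev : {rmorphism {poly int} -> R} := horner_eval j \o map_poly intr.
refine (@Mor freeT (ghostT R) ev (pair_rmorphism (ev \o free_res) (free_mark xi j))
  (fun=> erefl) (fun=> erefl) _ _) => p.
- apply: injective_projections.
    exact: etrans (congr1 ev (free_res_tr p)) (rmorphD ev p p).
  exact: free_mark_tr.
- apply: injective_projections.
    exact: etrans (congr1 ev (free_res_norm p)) (rmorphM ev p p).
  exact: free_mark_norm.
Defined.
End FreeGhost.

Lemma free_ghost_mark (R : comNzRingType) (j xi : R) b :
  (mor_C (free_ghost j xi) b).2 = free_mark xi j b.
Proof. by []. Qed.

(** * Homogeneous elements of degree 1 and 2 *)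

Lemma homog_C_x : homog_C 1 free_x.
Proof.
exists 'X%:P => // i j; rewrite coefC; case: j => [|j] /=; last by rewrite coef0 eqxx.
by rewrite coefX; case: (i =P 1) => [->|]; rewrite ?eqxx.
Qed.

Lemma homog_C1P (z : free_C) :
  homog_C 1 z -> exists d, z = free_scal d * free_x :> free_C.
Proof.
case=> P homP ->; have P0 i j : (i + 2 * j != 1)%N -> P`_j`_i = 0.
  by move=> ij; apply/eqP; apply: contraNT ij => /homP ->.
exists P`_0`_1.
rewrite -[free_scal _]/(free_pi _%:P%:P) /free_x -(rmorphM free_pi); congr (free_pi _).
apply/polyP=> j; rewrite -!polyCM coefC; apply/polyP=> i.
case: j => [|j] /=; last by rewrite coef0 P0 //; lia.
rewrite coefCM coefX; case: eqP => [->|ni]; rewrite ?mulr1 // mulr0 P0 //; lia.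
Qed.

Lemma homog_C2P (z : free_C) : homog_C 2 z ->
  exists a b, z = free_scal a * free_x ^+ 2 + free_scal b * free_n :> free_C.
Proof.
case=> P homP ->; have P0 i j : (i + 2 * j != 2)%N -> P`_j`_i = 0.
  by move=> ij; apply/eqP; apply: contraNT ij => /homP ->.
exists P`_0`_2, P`_1`_0.
transitivity (free_pi (((P`_0`_2)%:P * 'X^2)%:P + (P`_1`_0)%:P%:P * 'X)); last first.
  by rewrite polyCM polyC_exp (rmorphD free_pi) !(rmorphM free_pi).
congr (free_pi _).
apply/polyP=> j; rewrite coefD coefC coefCM coefX; apply/polyP=> i.
case: j => [|[|j]] /=.
- rewrite mulr0 addr0 coefCM coefXn.
  case: eqP => [->|ni]; rewrite ?mulr1 // mulr0 P0 //; lia.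
- rewrite add0r mulr1 coefC; case: eqP => [->//|ni]; rewrite P0 //; lia.
- by rewrite mulr0 addr0 coef0 P0 //; lia.
Qed.

(** Evaluation of the generic element of degree 2, with the values of the
    generators as variables: unification then never has to compare elements of
    the quotient rings. *)
Lemma rmorph_quadratic (S R : comPzRingType) (f : {rmorphism S -> R})
    (A B X N : S) (a b x n : R) :
  f A = a -> f B = b -> f X = x -> f N = n ->
  f (A * X ^+ 2 + B * N) = a * x ^+ 2 + b * n.
Proof. by move=> <- <- <- <-; rewrite !expr2 rmorphD !rmorphM. Qed.

(** * Constraints on the action, on phi and on psi *)

Section Action.
Variables (phi : mor freeT freeT) (psi : mor freeT burnsideT).
Hypothesis phi_y : mor_e phi ('X : {poly int}) = ('X^2 : {poly int}).
Hypothesis psi_y : mor_e psi ('X : {poly int}) = (- 1 : int).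
Hypothesis phi_deg : doubles_degree phi.
Variable tauX : alg_action free_unit.
Hypothesis tauX_x : mor_e tauX ('X : {poly int}) = (- 'X : {poly int}).
Hypothesis tauX_deg : preserves_degree tauX.
Hypothesis tauX_phi : tauX \oT phi =T phi \oT mor_id freeT.

Lemma tauX_scal b : mor_C tauX (free_scal b) = free_scal b.
Proof. exact: (act_linear tauX).2. Qed.

Lemma tauX_x_mark : exists d : int, forall (R : comNzRingType) (xi nu : R),
  free_mark xi nu (mor_C tauX free_x) = d%:~R * xi.
Proof.
have [d dE] := homog_C1P ((tauX_deg 1).2 _ homog_C_x).
exists (burn_mark d) => R xi nu.
by rewrite dE rmorphM free_mark_scal free_mark_x.
Qed.

(** tau(n_* ) = norm(-x), and the norm is additive modulo transfers. *)
Lemma tauX_n_mark (R : comNzRingType) (xi nu : R) :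
  free_mark xi nu (mor_C tauX free_n) = - nu.
Proof.
have -> : free_n = @norm freeT ('X : {poly int}) by rewrite /= free_normX.
by rewrite mor_norm tauX_x [LHS]free_mark_norm rmorphN /= map_polyX !hornerE.
Qed.

Lemma res_phi_y : free_res (mor_C phi free_x) = 'X^2.
Proof.
exact: etrans (esym (mor_res phi free_x)) (etrans (congr1 (mor_e phi) free_res_x) phi_y).
Qed.

Lemma res_psi_y : burn_res (mor_C psi free_x) = - 1.
Proof.
exact: etrans (esym (mor_res psi free_x)) (etrans (congr1 (mor_e psi) free_res_x) psi_y).
Qed.

(** The coefficient of n_* in phi(y_* ) has mark 0 because tau fixes phi(y_* ) and
    negates n_* modulo transfers.  The coefficient of x_*^2 is then odd, since
    the restrictions of the two coefficients add up to 1. *)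
Lemma phi_y_mark : exists2 a : int, a != 0 & forall (R : comNzRingType) (xi nu : R),
  free_mark xi nu (mor_C phi free_x) = a%:~R * xi ^+ 2.
Proof.
have [a [b abE]] := homog_C2P ((phi_deg 1).2 _ homog_C_x).
have mE (R : comNzRingType) (xi nu : R) : free_mark xi nu (mor_C phi free_x) =
    (burn_mark a)%:~R * xi ^+ 2 + (burn_mark b)%:~R * nu.
  rewrite abE; apply: rmorph_quadratic; first exact: free_mark_scal.
  - exact: free_mark_scal.
  - exact: free_mark_x.
  - exact: free_mark_n.
have b0 : burn_mark b = 0.
  have [d dE] := tauX_x_mark.
  (* Putting x_* = 0 and n_* = 1 isolates the coefficient of n_*. *)
  have e : free_mark (0 : int) 1 (mor_C tauX (mor_C phi free_x)) =
      burn_mark a * (d%:~R * 0) ^+ 2 + burn_mark b * (- 1).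
    rewrite abE.
    apply: (rmorph_quadratic (f := free_mark (0 : int) 1 \o mor_C tauX)).
    - exact: etrans (congr1 _ (tauX_scal a)) (etrans (free_mark_scal _ _ a) (intz _)).
    - exact: etrans (congr1 _ (tauX_scal b)) (etrans (free_mark_scal _ _ b) (intz _)).
    - exact: dE.
    - exact: tauX_n_mark.
  have := congr1 (free_mark (0 : int) 1) (tauX_phi.2 free_x).
  by rewrite [LHS]e [RHS]mE !intz; lia.
exists (burn_mark a) => [|R xi nu]; last by rewrite mE b0 mul0r addr0.
(* Evaluating at x = 1 reads off the coefficient of x^2. *)
have /(congr1 (horner^~ 1)) :
    (burn_res a)%:P * 'X^2 + (burn_res b)%:P * 'X^2 = 'X^2 :> {poly int}.
  rewrite -[RHS]res_phi_y abE.
  apply/esym; apply: (rmorph_quadratic (f := free_res)).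
  - exact: free_res_scal.
  - exact: free_res_scal.
  - exact: free_res_x.
  - exact: free_res_n.
rewrite !(hornerD, hornerCM, hornerXn, expr1n, mulr1).
have [c cE] := burn_res_mark b; rewrite cE b0 => abr.
by apply: (@burn_mark_neq0 _ (- c)); lia.
Qed.

Lemma psi_y_mark_neq0 : burn_mark (mor_C psi free_x) != 0.
Proof. by apply: (@burn_mark_neq0 _ (- 1)); rewrite res_psi_y. Qed.

(** * Two morphisms out of G that separate a fixed element *)

(** The compatibility with phi and psi depends on xi only through its square,
    hence holds for xi and for - xi simultaneously. *)
Lemma free_ghost_comm : exists2 xi : algC, xi != 0 & forall z, z ^+ 2 = xi ^+ 2 ->
  free_ghost 'i z \oT phi =T free_ghost 'i z \oT free_unit \oT psi.
Proof.
have [a a0 aE] := phi_y_mark.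
pose xi : algC := sqrtC ((burn_mark (mor_C psi free_x))%:~R / a%:~R).
exists xi => [|z zE].
  by rewrite sqrtC_eq0 mulf_neq0 ?invr_eq0 ?intr_eq0 ?psi_y_mark_neq0.
apply: freeT_mor_uniq; apply: injective_projections.
  apply: etrans (congr1 (mor_e (free_ghost 'i z)) res_phi_y) _; apply/esym.
  apply: etrans (congr1 (mor_e (free_ghost 'i z)) (free_res_scal _)) _.
  by rewrite res_psi_y /= /horner_eval map_polyC map_polyXn /= !hornerE sqrCi.
rewrite [LHS]free_ghost_mark [RHS]free_ghost_mark.
by rewrite free_mark_scal aE zE sqrtCK mulrC divfK // intr_eq0.
Qed.

(** The fixed elements used are w + tau(w) for w = x_* and w = n_* x_*.  One of
    them may be invisible to the marks, depending on the sign by which tau acts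
    on x_*, but never both. *)
Lemma fixed_points_separate (G : rel_box phi psi) (tauG : alg_action (box_inr G)) :
  tauG \oT box_inl G =T box_inl G \oT tauX ->
  exists u v : mor G (ghostT algC),
    ~ (forall s, mor_C tauG s = s -> mor_C u s = mor_C v s).
Proof.
move=> tauG_inl; have [xi xi0 comm] := free_ghost_comm.
pose u := box_desc G (comm xi erefl); pose v := box_desc G (comm (- xi) (sqrrN xi)).
exists u, v => uv.
have uvX w : free_mark xi 'i (w + mor_C tauX w) = free_mark (- xi) 'i (w + mor_C tauX w).
  have uE z : mor_C u (mor_C (box_inl G) z) = mor_C (free_ghost 'i xi) z.
    exact: (box_desc_inl G (comm xi erefl)).2.
  have vE z : mor_C v (mor_C (box_inl G) z) = mor_C (free_ghost 'i (- xi)) z.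
    exact: (box_desc_inl G (comm (- xi) (sqrrN xi))).2.
  rewrite -!free_ghost_mark -uE -vE uv //.
  have wE : mor_C tauX (w + mor_C tauX w) = w + mor_C tauX w.
    rewrite (rmorphD (mor_C tauX)) addrC; congr (_ + _).
    exact: (act_invol tauX).2.
  exact: etrans (tauG_inl.2 _) (congr1 (mor_C (box_inl G)) wE).
have [d dE] := tauX_x_mark.
have := uvX (free_n * free_x); have := uvX free_x.
rewrite !rmorphM !(rmorphD (free_mark _ _)) !rmorphM !tauX_n_mark !dE.
rewrite !free_mark_x !free_mark_n; set c : algC := d%:~R => e1 e2.
(* The equation for n_* x_* plus i times the one for x_* eliminates d. *)
have : 4%:R * ('i * xi) = 0 :> algC.
  transitivity ('i * xi + - 'i * (c * xi) - ('i * - xi + - 'i * (c * - xi))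
    + 'i * (xi + c * xi - (- xi + c * - xi))); first by ring.
  by rewrite e1 e2 !subrr mulr0 addr0.
by apply/eqP; rewrite !mulf_neq0 ?neq0Ci ?pnatr_eq0.
Qed.
End Action.

Theorem proposition7p1
    (phi : mor freeT freeT) (psi : mor freeT burnsideT)
    (phi_y : mor_e phi ('X : {poly int}) = ('X^2 : {poly int}))
    (psi_y : mor_e psi ('X : {poly int}) = (- 1 : int))
    (phi_deg : doubles_degree phi)
    (G : rel_box phi psi)
    (tauX : alg_action free_unit)
    (tauX_x : mor_e tauX ('X : {poly int}) = (- 'X : {poly int}))
    (tauX_deg : preserves_degree tauX)
    (tauX_phi : tauX \oT phi =T phi \oT mor_id freeT)
    (tauG : alg_action (box_inr G))
    (tauG_inl : tauG \oT box_inl G =T box_inl G \oT tauX) :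
  ~ (exists f : mor burnsideT (fixedT tauG), is_iso f)
  /\
  forall (A2 : inv_two burnsideT) (G2 : inv_two G) (eta : mor A2 G2)
    (eta_loc : eta \oT loc_map A2 =T loc_map G2 \oT box_inr G)
    (tauG2 : alg_action eta)
    (tauG2_loc : tauG2 \oT loc_map G2 =T loc_map G2 \oT tauG),
  ~ galois tauG2.
Proof.
have [u [v uv]] := fixed_points_separate phi_y psi_y phi_deg tauX_x tauX_deg tauX_phi tauG_inl.
split=> [[f [g [_ [_ fg]]]]|A2 G2 eta eta_loc tauG2 tauG2_loc gal]; apply: uv => s s_fix.
  have sP : s \in fixed_by (mor_C tauG) by rewrite inE s_fix.
  have <- : mor_C (fixed_incl tauG \oT f) (mor_C g (FixedRing sP)) = s.
    by rewrite /= [X in fixed_val X](fg (FixedRing sP)).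
  exact: (burnsideT_mor_uniq (u \oT (fixed_incl tauG \oT f))
                             (v \oT (fixed_incl tauG \oT f))).2.
have U2 : two_invertible (ghostT algC).
  by apply: (@ghostT_two algC 2^-1); rewrite divff // pnatr_eq0.
have uE := (loc_descE G2 u U2).2 s; have vE := (loc_descE G2 v U2).2 s.
rewrite -[LHS]uE -[RHS]vE /=.
have [f [[g [_ [_ fg]]] fE]] := galois_fixed gal.
set s2 := mor_C (loc_map G2) s.
have sP : s2 \in fixed_by (mor_C tauG2).
  by rewrite inE; apply/eqP; rewrite [LHS](tauG2_loc.2 s) /= s_fix.
have <- : mor_C eta (mor_C g (FixedRing sP)) = s2.
  by rewrite -fE.2 /= [X in fixed_val X](fg (FixedRing sP)).
apply: (loc_uniq (p := loc_desc G2 u U2 \oT eta) (q := loc_desc G2 v U2 \oT eta) _).2.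
exact: burnsideT_mor_uniq.
Qed.
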